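(* Let $\ell$ be a positive integer, $[\ell]=\{1,\dots,\ell\}$, let $K$ be a finite set, let $I_k,J_k\subseteq[\ell]$ for each $k\in K$, and let $a_i,b_i\in\mathbb{R}$ for $i\in[\ell]$. For a symmetric set $D\subseteq[0,1]$ let $$\mathcal F(D)=\Bigl\{f\colon D\times[\ell]\to\mathbb{R}\ :\ \sum_{i\in I_k}a_i f(x,i)+\sum_{j\in J_k}b_j f(1-x,j)=0\ \text{ for all }x\in D,\ k\in K\Bigr\}.$$ Then for any integer $m>2$ the following are equivalent: (1) There exists a nontrivial $f\in\mathcal F([0,1])$. (2) There exists a nontrivial continuous piecewise linear $f\in\mathcal F([0,1])$ with $f(0,i)=f(1,i)=0$ for all $i=1,\dots,\ell$. (3) There exists a nontrivial $f\in\mathcal F(\{\tfrac1m,\tfrac{m-1}{m}\})$.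
   Context: A set $D\subseteq[0,1]$ is symmetric if $D=\{1-x:x\in D\}$. A function $f\colon D\times[\ell]\to\mathbb{R}$ is nontrivial if $f\not\equiv 0$. A function $f\colon[0,1]\times[\ell]\to\mathbb{R}$ is called (continuous) piecewise linear if for each $i\in[\ell]$ the function $f(\cdot,i)\colon[0,1]\to\mathbb{R}$ is (continuous) piecewise linear. *)

(* Defs.v *)
From HB Require Import structures.
From mathcomp Require Import all_boot all_order all_algebra.
From mathcomp Require Import all_classical all_reals all_analysis.
From mathcomp Require Import ring lra.

Set Implicit Arguments.
Unset Strict Implicit.
Unset Printing Implicit Defensive.

Import Order.TTheory GRing.Theory Num.Theory.
Import numFieldNormedType.Exports.

Local Open Scope classical_set_scope.
Local Open Scope ring_scope.

(* A function D x [l] -> R is represented by a total f : R -> 'I_l -> R of which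
   only the values on D are ever inspected; [l] = {1, ..., l} is 'I_l. *)

Definition symmetric_set (R : realType) (D : set R) : Prop :=
  D `<=` `[0, 1] /\ D = [set 1 - x | x in D].

Definition solution_set (R : realType) (l : nat) (K : finType)
    (I J : K -> {set 'I_l}) (a b : 'I_l -> R) (D : set R) :
    set (R -> 'I_l -> R) :=
  [set f | forall x k, D x ->
     \sum_(i in I k) a i * f x i + \sum_(j in J k) b j * f (1 - x) j = 0].

Definition nontrivial_on (R : realType) (l : nat) (D : set R)
    (f : R -> 'I_l -> R) : Prop :=
  exists x i, D x /\ f x i != 0.

(* No condition is put on the values at the breakpoints, so that a piecewise
   linear function may be discontinuous. *)
Definition piecewise_linear (R : realType) (g : R -> R) : Prop :=
  exists2 s : seq R, itv_partition 0 1 s &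
    forall n, (n < size s)%N -> exists c d : R,
      forall x, nth 1 (0 :: s) n < x < nth 1 s n -> g x = c * x + d.

Definition continuous_piecewise_linear (R : realType) (l : nat)
    (f : R -> 'I_l -> R) : Prop :=
  forall i, piecewise_linear (f^~ i) /\
            {within `[0, 1], continuous (f^~ i)}.

Definition pair_set (R : realType) (m : nat) : set R :=
  [set m%:R^-1; (m%:R - 1) / m%:R].
Arguments pair_set : clear implicits.

Lemma symmetric_unit_interval (R : realType) :
  symmetric_set (`[0, 1] : set R).
Proof.
split=> //; apply/seteqP; split=> x /= x01.
  by exists (1 - x); rewrite /= ?in_itv /= in x01 *; lra.
by case: x01 => y; rewrite in_itv /= => y01 <-; rewrite in_itv /=; lra.
Qed.

Lemma symmetric_pair_set (R : realType) (m : nat) :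
  (2 < m)%N -> symmetric_set (pair_set R m).
Proof.
move=> m2; have m0 : (m%:R : R) != 0 by rewrite pnatr_eq0; case: m m2.
have E : (m%:R - 1) / m%:R = 1 - m%:R^-1 :> R by field.
have m1 : (m%:R^-1 : R) <= 1 by rewrite invf_le1 ?ler1n ?ltr0n; case: m m2 {m0 E}.
have m0' : 0 <= (m%:R^-1 : R) by rewrite invr_ge0 ler0n.
rewrite /pair_set E; split; first by move=> x /= [] ->; rewrite in_itv /=; lra.
apply/seteqP; split=> x /=.
  by case=> ->; [exists (1 - m%:R^-1); [right|lra] | exists m%:R^-1; [left|]].
by case=> y [] -> <-; [right|left; lra].
Qed.

(* Main.v *)
Require Import Defs.
From mathcomp Require Import all_boot all_order all_algebra.
From mathcomp Require Import all_classical all_reals all_analysis.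
From mathcomp Require Import ring lra.
Import Order.TTheory GRing.Theory Num.Theory.
Import numFieldNormedType.Exports.
Local Open Scope classical_set_scope.
Local Open Scope ring_scope.

(** The equations couple the value of [f] at [x] only with its value at
    [1 - x].  So everything happens on a single pair of mirror points: the
    vectors [u = f x] and [v = f (1 - x)] satisfy the equations at [x] and at
    [1 - x], which form a homogeneous linear system in [(u, v)] that is
    unchanged when [u] and [v] are exchanged and that does not depend on [x]
    ([mirror_solution_of]).  Each of the three conditions says that this system
    has a nonzero solution.

    Conversely, a solution [(u, v)] spreads out to any domain: for every scalar
    function [phi], the function [phi x * u + phi (1 - x) * v] satisfies all the
    equations, by linearity and the exchange symmetry ([spread_solution]).
    Choosing for [phi] a tent over [0, 2/3] with apex at 1/3 gives the
    continuous piecewise linear solution, and choosing the indicator of [1/m]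
    gives the solution on the two-point set, where [m > 2] ensures that the two
    points are distinct, so that [u] and [v] can be prescribed independently. *)

Definition mirror_solution {R : realType} {l : nat} {K : finType}
    (I J : K -> {set 'I_l}) (a b u v : 'I_l -> R) : Prop :=
  forall k, \sum_(i in I k) a i * u i + \sum_(j in J k) b j * v j = 0 /\
            \sum_(i in I k) a i * v i + \sum_(j in J k) b j * u j = 0.

(** Evaluating at the two mirror points.  At the centre [x = 1/2] they
    coincide and the pair is [(u, u)], so no case distinction arises. *)
Lemma mirror_solution_of {R : realType} {l : nat} {K : finType}
    {I J : K -> {set 'I_l}} {a b : 'I_l -> R} {D : set R} :
  symmetric_set D ->
  (exists f, solution_set I J a b D f /\ nontrivial_on D f) ->
  exists u v i, mirror_solution I J a b u v /\ u i != 0.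
Proof.
move=> [_ symD] [f [solf [x [i [Dx fxi]]]]].
exists (f x), (f (1 - x)), i; split=> // k; split; first exact: solf.
have D1x : D (1 - x) by rewrite symD; exists x.
by have := solf _ k D1x; rewrite subKr.
Qed.

Definition spread {R : realType} {l : nat} (phi : R -> R) (u v : 'I_l -> R)
    (x : R) (i : 'I_l) : R :=
  phi x * u i + phi (1 - x) * v i.

(** The equation of the spread function at [x] is [phi x] times the equation
    of [(u, v)] plus [phi (1 - x)] times the equation of [(v, u)]. *)
Lemma spread_solution {R : realType} {l : nat} {K : finType}
    {I J : K -> {set 'I_l}} {a b u v : 'I_l -> R} (phi : R -> R) (D : set R) :
  mirror_solution I J a b u v -> solution_set I J a b D (spread phi u v).
Proof.
move=> sol x k _; have [uv vu] := sol k.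
have lin (A : {set 'I_l}) (c w z : 'I_l -> R) p q :
    \sum_(i in A) c i * (p * w i + q * z i) =
    p * (\sum_(i in A) c i * w i) + q * (\sum_(i in A) c i * z i).
  rewrite !mulr_sumr -big_split /=; apply: eq_bigr => i _; ring.
rewrite /spread subKr !lin.
transitivity (phi x * (\sum_(i in I k) a i * u i + \sum_(j in J k) b j * v j)
  + phi (1 - x) * (\sum_(i in I k) a i * v i + \sum_(j in J k) b j * u j)).
  by ring.
by rewrite uv vu !mulr0 addr0.
Qed.

Definition tent {R : realType} (x : R) : R :=
  Num.max 0 (Num.min x (2 / 3 - x)).

Lemma tent_left {R : realType} (x : R) : 0 <= x <= 1 / 3 -> tent x = x.
Proof. by move=> ?; rewrite /tent min_l ?max_r //; lra. Qed.

Lemma tent_middle {R : realType} (x : R) :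
  1 / 3 <= x <= 2 / 3 -> tent x = 2 / 3 - x.
Proof. by move=> ?; rewrite /tent min_r ?max_r //; lra. Qed.

Lemma tent_right {R : realType} (x : R) : 2 / 3 <= x -> tent x = 0.
Proof. by move=> ?; rewrite /tent min_r ?max_l //; lra. Qed.

Lemma continuous_tent {R : realType} : continuous (@tent R).
Proof.
apply: (@max_fun_continuous _ R R (cst 0) (id \min (fun y => 2 / 3 - y))).
  exact: cst_continuous.
apply: min_fun_continuous => x; first exact: cvg_id.
by apply: cvgB; [exact: cvg_cst | exact: cvg_id].
Qed.

(** The tent spread over [u] and [v] interpolates linearly between the values
    [0], [u i / 3], [v i / 3] and [0] at the points 0, 1/3, 2/3 and 1. *)
Lemma spread_tent_piecewise_linear {R : realType} {l : nat}
    (u v : 'I_l -> R) (i : 'I_l) :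
  piecewise_linear (spread tent u v ^~ i).
Proof.
exists [:: 1 / 3; 2 / 3; 1].
  by rewrite /itv_partition /=; split=> //; apply/and4P; split=> //; lra.
case=> [|[|[|n]]] //= _.
- exists (u i), 0 => x xI.
  by rewrite /spread tent_left ?(@tent_right _ (1 - x)); [ring | lra | lra].
- exists (v i - u i), (2 / 3 * u i - 1 / 3 * v i) => x xI.
  by rewrite /spread !tent_middle; [field | lra | lra].
- exists (- v i), (v i) => x xI.
  by rewrite /spread tent_right ?(@tent_left _ (1 - x)); [ring | lra | lra].
Qed.

Lemma spread_tent_continuous {R : realType} {l : nat}
    (u v : 'I_l -> R) (i : 'I_l) :
  continuous (spread tent u v ^~ i).
Proof.
move=> x; apply: cvgD; apply: cvgM; try exact: cvg_cst.
  exact: continuous_tent.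
apply: (@continuous_comp R R R (fun y => 1 - y) tent).
  by apply: cvgB; [exact: cvg_cst | exact: cvg_id].
exact: continuous_tent.
Qed.

Lemma mirror_solution_interval {R : realType} {l : nat} {K : finType}
    {I J : K -> {set 'I_l}} {a b u v : 'I_l -> R} {i : 'I_l} :
  mirror_solution I J a b u v -> u i != 0 ->
  exists f : R -> 'I_l -> R,
    [/\ solution_set I J a b `[0, 1] f,
        nontrivial_on `[0, 1] f,
        continuous_piecewise_linear f
      & forall i, f 0 i = 0 /\ f 1 i = 0].
Proof.
move=> sol ui; exists (spread tent u v); split.
- exact: spread_solution.
- exists (1 / 3), i; split; first by rewrite /= in_itv /=; lra.
  rewrite /spread tent_left ?tent_right ?mul0r ?addr0 ?mulf_neq0 //; lra.
- move=> j; split; first exact: spread_tent_piecewise_linear.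
  exact/continuous_subspaceT/spread_tent_continuous.
- move=> j; rewrite /spread subr0 subrr.
  by rewrite tent_left ?tent_right ?mul0r ?addr0; [| lra | lra].
Qed.

Lemma mirror_solution_pair {R : realType} {l : nat} {K : finType}
    {I J : K -> {set 'I_l}} {a b u v : 'I_l -> R} {i : 'I_l} {m : nat} :
  (2 < m)%N -> mirror_solution I J a b u v -> u i != 0 ->
  exists f : R -> 'I_l -> R,
    solution_set I J a b (pair_set R m) f /\ nontrivial_on (pair_set R m) f.
Proof.
move=> m2 sol ui; exists (spread (fun x => (x == m%:R^-1)%:R) u v).
split; first exact: spread_solution.
exists m%:R^-1, i; split; first by left.
have mirrored_neq : 1 - m%:R^-1 != m%:R^-1 :> R.
  have m2R : (2 : R) < m%:R by rewrite ltr_nat.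
  have : (m%:R^-1 : R) < 2^-1 by rewrite ltf_pV2 ?posrE //; lra.
  by move=> ?; apply/eqP; lra.
by rewrite /spread eqxx (negbTE mirrored_neq) mul1r mul0r addr0.
Qed.

Theorem lemma5p3 (R : realType) (l : nat) (hl : (0 < l)%N) (K : finType)
    (I J : K -> {set 'I_l}) (a b : 'I_l -> R) (m : nat) (hm : (2 < m)%N) :
  [<-> exists f : R -> 'I_l -> R,
         solution_set I J a b `[0, 1] f /\ nontrivial_on `[0, 1] f;
       exists f : R -> 'I_l -> R,
         [/\ solution_set I J a b `[0, 1] f,
             nontrivial_on `[0, 1] f,
             continuous_piecewise_linear f
           & forall i, f 0 i = 0 /\ f 1 i = 0];
       exists f : R -> 'I_l -> R,
         solution_set I J a b (pair_set R m) f /\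
         nontrivial_on (pair_set R m) f].
Proof.
tfae.
- move=> /(mirror_solution_of (symmetric_unit_interval R)) [u [v [i [sol ui]]]].
  exact: mirror_solution_interval sol ui.
- move=> [f [solf ntf _ _]].
  have [|u [v [i [sol ui]]]] :=
    @mirror_solution_of R l K I J a b _ (symmetric_unit_interval R).
    by exists f.
  exact: mirror_solution_pair hm sol ui.
- move=> /(mirror_solution_of (symmetric_pair_set R hm)) [u [v [i [sol ui]]]].
  have [f [solf ntf _ _]] := mirror_solution_interval sol ui.
  by exists f.
Qed.
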